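(* Let $I\subset[0,\infty)$ be an interval, let $a,b\in I$ with $a<b$, and let $f,g:I\to\mathbb{R}$ be functions such that $f$, $g$ and $fg$ are in $L^{1}([a,b])$. Suppose that $f$ is $s_{1}$-convex in the second sense on $[a,b]$ and $g$ is $s_{2}$-convex in the second sense on $[a,b]$ for some $s_{1},s_{2}\in(0,1]$. Then $$ \begin{aligned} &\frac{f(a)}{(b-a)^{s_{1}+1}}\int_{a}^{b}(b-x)^{s_{1}}g(x)\,dx+\frac{f(b)}{(b-a)^{s_{1}+1}}\int_{a}^{b}(x-a)^{s_{1}}g(x)\,dx\\ &\quad+\frac{g(a)}{(b-a)^{s_{2}+1}}\int_{a}^{b}(b-x)^{s_{2}}f(x)\,dx+\frac{g(b)}{(b-a)^{s_{2}+1}}\int_{a}^{b}(x-a)^{s_{2}}f(x)\,dx\\ &\le \frac{1}{b-a}\int_{a}^{b}f(x)g(x)\,dx+\frac{1}{s_{1}+s_{2}+1}\left[M(a,b)+s_{1}s_{2}\frac{\Gamma(s_{1})\Gamma(s_{2})}{\Gamma(s_{1}+s_{2}+1)}N(a,b)\right], \end{aligned} $$ where $M(a,b)=f(a)g(a)+f(b)g(b)$, $N(a,b)=f(a)g(b)+f(b)g(a)$, and $\Gamma$ is the Euler gamma function.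
   Context: For a fixed $s\in(0,1]$, a real-valued function $h$ is $s$-convex in the second sense on an interval $J\subset[0,\infty)$ if $h(tx+(1-t)y)\le t^{s}h(x)+(1-t)^{s}h(y)$ for all $x,y\in J$ and all $t\in[0,1]$. (For $s=1$ this is ordinary convexity.) *)

(* Defs.v *)
From HB Require Import structures.
From mathcomp Require Import all_boot all_order all_algebra.
From mathcomp Require Import all_classical all_reals all_analysis.

Set Implicit Arguments.
Unset Strict Implicit.
Unset Printing Implicit Defensive.

Import Order.TTheory GRing.Theory Num.Theory.
Import numFieldNormedType.Exports.

Local Open Scope classical_set_scope.
Local Open Scope ring_scope.

(* Meant for [0 < s <= 1] and [J] an interval of nonnegative reals. Since
   [0 `^ s = 0] for [s != 0], the values [t = 0] and [t = 1] follow the usual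
   convention [0 ^ s = 0]. *)
Definition s_convex_second (R : realType) (s : R) (J : set R) (h : R -> R) :=
  forall x y t : R, J x -> J y -> 0 <= t <= 1 ->
    h (t * x + (1 - t) * y) <= t `^ s * h x + (1 - t) `^ s * h y.

(* Euler's integral; it is the Gamma function only for [0 < z]. *)
Definition Gamma (R : realType) (z : R) : R :=
  \int[@lebesgue_measure R]_(t in `]0, +oo[) (t `^ (z - 1) * expR (- t)).

(* Membership in L^1(D) for a real-valued function. [lebesgue_measure] lives on
   the Borel sigma-algebra, so this asks for Borel measurability on [D]. For an
   s-convex function (0 < s <= 1) on a segment this is no restriction: such a
   function is continuous on the interior of the segment. *)
Definition L1_on (R : realType) (D : set R) (h : R -> R) : Prop :=
  (@lebesgue_measure R).-integrable D (EFin \o h).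

(* Main.v *)
Require Import Defs.
From HB Require Import structures.
From mathcomp Require Import all_boot all_order all_algebra.
From mathcomp Require Import all_classical all_reals all_analysis.
From mathcomp Require Import measurable_realfun ring lra.

Import Order.TTheory GRing.Theory Num.Theory.
Import numFieldNormedType.Exports.

Local Open Scope classical_set_scope.
Local Open Scope ring_scope.

(** Let [P] and [Q] be the bounds that [s]-convexity gives for [f] and [g] in
    terms of their values at the endpoints, for instance
    [P x = ((b - x) `^ s1 * f a + (x - a) `^ s1 * f b) / (b - a) `^ s1]
    (lemma [s_convex_second_chord]). Then [f <= P] and [g <= Q] on [[a, b]], so
    [0 <= (P - f) * (Q - g)], that is, [P * g + Q * f <= f * g + P * Q].
    Averaging over [[a, b]], the left-hand side becomes the four weighted
    integrals, and [f * g] its own mean; it remains to compute the mean of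
    [P * Q], which is a combination of the integrals of
    [(x - a) `^ p * (b - x) `^ q].

    Those are Beta integrals, so the other half of the proof is Euler's identity
    [B(p, q) = Gamma p * Gamma q / Gamma (p + q)] for real [p, q > 0], together
    with [Gamma (p + 1) = p * Gamma p] and [0 < Gamma p]. Everything is derived
    for nonnegative extended-real integrals over the whole line, where neither
    Tonelli's theorem nor affine changes of variable have integrability
    conditions. With [w_p x = x `^ (p - 1)] for [0 < x] and [0] elsewhere:
    - rescaling by [u] shows that the convolution of [w_p] and [w_q] at [u] is
      [w_(p + q) u * B(p, q)] ([tpow_convolution]);
    - since [expR (- x) * expR (- (u - x))] does not depend on [x], Tonelli turns
      the product of two Gamma integrals into the integral of that convolution
      against [expR (- u)], hence Euler's identity ([eGammaM]);
    - the case [q = 1], where [B(p, 1) = p^-1] and [Gamma 1 = 1], is the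
      functional equation ([eGammaS]), which spares an improper integration by
      parts;
    - a translation of the convolution formula gives the Beta integral on any
      segment ([Rintegral_powRM]). *)

(** * Affine change of variables *)

Section affine.
Context {R : realType}.
Notation mu := (@lebesgue_measure R).

Lemma measurable_affine (c d : R) :
  measurable_fun setT (fun x : R => c * x + d : measurableTypeR R).
Proof. by apply: measurable_funD => //; apply: measurable_funM. Qed.

(** The two measures agree on the half-open intervals, which determine Lebesgue
    measure. *)
Lemma lebesgue_measure_affine (c d : R) (A : set R) : 0 < c -> measurable A ->
  (c%:E * pushforward mu (fun x : R => (c * x + d)%R : measurableTypeR R) A)%E = mu A.
Proof.
move=> c0 mA.
pose k := NngNum (ltW c0).
have := @lebesgue_measure_unique R
  (mscale k (pushforward mu (fun x : R => c * x + d : measurableTypeR R))).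
move/(_ (measurable_affine c d) _ A mA) => -> // _ [[x y]] _ <-.
rewrite -[RHS]/(c%:E * mu ((fun z : R => (c * z + d)%R) @^-1` `]x, y]))%E.
have -> : (fun z : R => c * z + d) @^-1` `]x, y] = `]((x - d) / c), ((y - d) / c)]%classic.
  apply/seteqP; split => z /=; rewrite !in_itv/= ltr_pdivrMr// ler_pdivlMr//;
    by rewrite (mulrC z) ltrBlDr lerBrDr.
rewrite !lebesgue_measure_itv/= !lte_fin ltr_pM2r ?invr_gt0// ltrD2r.
case: ifP => _; last by rewrite mule0.
by rewrite -EFinM; congr EFin; field; rewrite gt_eqF.
Qed.

(** Both sides are integrals against Lebesgue measure, which is [c] times its own
    pushforward by the affine map. *)
Lemma ge0_integral_affine (c d : R) (F : R -> \bar R) : 0 < c ->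
  measurable_fun setT F -> (forall x, (0 <= F x)%E) ->
  (\int[mu]_x F x = c%:E * \int[mu]_x F (c * x + d)%R)%E.
Proof.
move=> c0 mF F0.
pose phi := (fun x : R => c * x + d : measurableTypeR R).
have mphi : measurable_fun setT phi := measurable_affine c d.
transitivity (c%:E * \int[pushforward mu phi]_x F x)%E; last first.
  by rewrite ge0_integral_pushforward.
have := @ge0_integral_mscale _ _ _ (pushforward mu phi) setT measurableT (NngNum (ltW c0)) F.
move=> /(_ mphi mF (fun x _ => F0 x)) <-.
apply: eq_measure_integral => A mA _.
by rewrite -[LHS](@lebesgue_measure_affine c d A c0 mA).
Qed.

End affine.

(** * Gamma and Beta integrals and Euler's identity *)

Section beta_gamma.
Context {R : realType}.
Notation mu := (@lebesgue_measure R).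
Implicit Types p q x u : R.

(** Truncated to the positive half-line, so that Gamma and Beta integrals, and
    integrals over segments, are all integrals or convolutions over the whole
    line; without the truncation, [powR] is [1] on negative numbers. *)
Definition tpow p x : R := if 0 < x then x `^ (p - 1) else 0.

Definition eGamma p : \bar R := (\int[mu]_x (tpow p x * expR (- x))%:E)%E.

Definition eBeta p q : \bar R := (\int[mu]_x (tpow p x * tpow q (1 - x))%:E)%E.

Lemma tpow_ge0 p x : 0 <= tpow p x.
Proof. by rewrite /tpow; case: ifP => // _; exact: powR_ge0. Qed.

Lemma measurable_tpow p : measurable_fun setT (tpow p).
Proof.
apply: measurable_fun_ifT => //; exact: measurable_fun_ltr.
Qed.

Lemma measurable_tpow_convolution p q u :
  measurable_fun setT (fun x => (tpow p x * tpow q (u - x))%:E).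
Proof.
apply/measurable_EFinP/measurable_funM; first exact: measurable_tpow.
by apply: measurableT_comp; [exact: measurable_tpow|exact: measurable_funB].
Qed.

Lemma measurable_eGamma_integrand p :
  measurable_fun setT (fun x => (tpow p x * expR (- x))%:E).
Proof.
apply/measurable_EFinP/measurable_funM; first exact: measurable_tpow.
by apply: measurableT_comp => //; exact: measurable_funN.
Qed.

Lemma eGamma_ge0 p : (0 <= eGamma p)%E.
Proof.
by apply: integral_ge0 => x _; rewrite lee_fin mulr_ge0 ?tpow_ge0 ?expR_ge0.
Qed.

Lemma eBeta_ge0 p q : (0 <= eBeta p q)%E.
Proof. by apply: integral_ge0 => x _; rewrite lee_fin mulr_ge0 ?tpow_ge0. Qed.

(** For [0 < u] the substitution [x = u * t] takes a power of [u] out of each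
    factor; for [u <= 0] the two supports are disjoint. *)
Lemma tpow_convolution p q u :
  (\int[mu]_x (tpow p x * tpow q (u - x))%:E = (tpow (p + q) u)%:E * eBeta p q)%E.
Proof.
have [u0|u0] := ltP 0 u; last first.
  rewrite {3}/tpow ltNge u0/= mul0e.
  apply: integral0_eq => x _; rewrite /tpow.
  case: ltP => [x0|]; last by rewrite mul0r.
  by rewrite ltNge (_ : u - x <= 0) ?mulr0//; lra.
rewrite (@ge0_integral_affine _ u 0)//; last 2 first.
  exact: measurable_tpow_convolution.
  by move=> x; rewrite lee_fin mulr_ge0 ?tpow_ge0.
under eq_integral => x _.
  rewrite (_ : _ * _ = u `^ (p - 1) * u `^ (q - 1) * (tpow p x * tpow q (1 - x))); last first.
    rewrite addr0 (_ : u - u * x = u * (1 - x)); last by ring.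
    rewrite /tpow !pmulr_rgt0//.
    case: ltP => x0; case: ltP => x1; rewrite ?(mulr0, mul0r)//.
    by rewrite !powRM ?(ltW x0) ?(ltW x1) ?(ltW u0)//; ring.
  rewrite EFinM; over.
rewrite ge0_integralZl//; last 3 first.
  exact: measurable_tpow_convolution.
  by move=> x; rewrite lee_fin mulr_ge0 ?tpow_ge0.
  by rewrite lee_fin mulr_ge0 ?powR_ge0.
rewrite muleA -EFinM /tpow u0; congr (_%:E * _)%E.
rewrite -{1}(powRr1 (ltW u0)) -!powRD ?(gt_eqF u0) ?implybT//.
by congr (_ `^ _); ring.
Qed.

(** Substituting [y = u - x] in the inner integral merges the two exponentials
    into [expR (- u)]; exchanging the integrals leaves a convolution. *)
Lemma eGammaM p q : (eGamma p * eGamma q = eBeta p q * eGamma (p + q))%E.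
Proof.
have mexp : measurable_fun [set: R] (fun x => expR (- x)).
  by apply: measurableT_comp => //; exact: measurable_funN.
have mG := measurable_eGamma_integrand.
have G0 r x : (0 <= (tpow r x * expR (- x))%:E)%E.
  by rewrite lee_fin mulr_ge0 ?tpow_ge0 ?expR_ge0.
pose F (z : R * R) := (tpow p z.1 * tpow q (z.2 - z.1) * expR (- z.2))%:E.
have mF : measurable_fun setT F.
  apply/measurable_EFinP/measurable_funM; last exact: (measurableT_comp mexp).
  apply: measurable_funM.
    by apply: measurableT_comp; first exact: measurable_tpow.
  apply: measurableT_comp; first exact: measurable_tpow.
  exact: measurable_funB.
have F0 z : (0 <= F z)%E by rewrite lee_fin !mulr_ge0 ?tpow_ge0 ?expR_ge0.
transitivity (\int[mu]_x \int[mu]_u F (x, u))%E.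
  rewrite muleC -ge0_integralZl ?eGamma_ge0//; last exact: mG.
  apply: eq_integral => x _; rewrite muleC -ge0_integralZl//; last exact: mG.
  rewrite [RHS](@ge0_integral_affine _ 1 x)//; last exact: measurable_fun_pair2.
  rewrite mul1e; apply: eq_integral => y _; rewrite /F/= -EFinM mul1r addrK.
  by rewrite opprD expRD; congr EFin; ring.
rewrite (@fubini_tonelli _ _ _ _ _ mu mu F)//.
rewrite -ge0_integralZl ?eBeta_ge0//; last exact: mG.
apply: eq_integral => u _.
under eq_integral do rewrite /F/= mulrC EFinM.
rewrite ge0_integralZl ?lee_fin ?expR_ge0//; last 2 first.
  exact: measurable_tpow_convolution.
  by move=> x; rewrite lee_fin mulr_ge0 ?tpow_ge0.
by rewrite tpow_convolution EFinM muleA muleC (muleC (expR _)%:E).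
Qed.

(** Stopping at [e] keeps away from the singularity that [x `^ (p - 1)] has at [0]
    when [p < 1], so that the fundamental theorem of calculus applies. *)
Lemma integral_powR_segment p (e : R) : 0 < e < 1 ->
  (\int[mu]_(x in `[e, 1%R]) (p * x `^ (p - 1))%:E = (1 - e `^ p)%:E)%E.
Proof.
move=> /andP[e0 e1].
have dpow (r x : R) : 0 < x -> derivable (@powR R ^~ r) x 1.
  by move=> x0; apply: derivable_powR; rewrite in_itv/= andbT.
have cpow (r x : R) : 0 < x -> {for x, continuous (@powR R ^~ r)}.
  by move=> x0; apply/differentiable_continuous; rewrite -derivable1_diffP; exact: dpow.
rewrite (@continuous_FTC2 _ _ (@powR R ^~ p))//.
- by rewrite powR1.
- apply: derivable_within_continuous => x; rewrite in_itv/= => /andP[ex _].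
  by apply: derivableM => //; apply: dpow; exact: lt_le_trans ex.
- split.
  + by move=> x; rewrite in_itv/= => /andP[ex _]; apply: dpow; exact: lt_trans ex.
  + by apply: cvg_at_right_filter; exact: cpow.
  + by apply: cvg_at_left_filter; exact: cpow.
- by move=> x; rewrite in_itv/= => /andP[ex _]; rewrite powR_derive1// in_itv/= andbT (lt_trans e0).
Qed.

(** Monotone convergence along the segments [[(n + 2)^-1, 1]]. *)
Lemma integral_powR_unit p : 0 < p ->
  (\int[mu]_(x in `]0%R, 1%R]) (p * x `^ (p - 1))%:E = 1)%E.
Proof.
move=> p0.
have mf D : measurable_fun D (fun x => (p * x `^ (p - 1))%:E).
  by apply/measurable_EFinP; apply: measurable_funTS; apply: measurable_funM.
(* [n.+2] rather than [n.+1] because the segments must have distinct ends *)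
pose F n := `[(n.+2%:R^-1 : R), 1]%classic.
have -> : `]0%R, 1%R]%classic = \bigcup_n F n.
  apply/seteqP; split => x; rewrite /= in_itv/=.
    move=> /andP[x0 x1].
    have /cvgrPdist_lt/(_ _ x0) [n _ /(_ n (leqnn n))] := @cvg_harmonic R.
    rewrite /= sub0r normrN ger0_norm ?invr_ge0// => nx.
    exists n => //; rewrite /F/= in_itv/= x1 andbT (le_trans _ (ltW nx))//.
    by rewrite lef_pV2 ?posrE// ler_nat.
  move=> [n _]; rewrite /F/= in_itv/= => /andP[nx ->]; rewrite andbT.
  by rewrite (lt_le_trans _ nx).
have Fcvg : (\int[mu]_(x in F n) (p * x `^ (p - 1))%:E @[n --> \oo] -->
    \int[mu]_(x in \bigcup_n F n) (p * x `^ (p - 1))%:E)%E.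
  apply: ge0_nondecreasing_set_cvg_integral => [|n|n|n x _].
  - apply/nondecreasing_seqP => n; rewrite subsetEset; apply: subset_itvr.
    by rewrite bnd_simp lef_pV2 ?posrE// ler_nat.
  - exact: measurable_itv.
  - exact: mf.
  - by rewrite lee_fin mulr_ge0 ?powR_ge0// ltW.
rewrite -(cvg_lim _ Fcvg)//.
apply/cvg_lim => //.
rewrite (_ : (fun _ => _) = (fun n => (1 - n.+2%:R^-1 `^ p)%:E)); last first.
  apply/funext => n; apply: integral_powR_segment.
  by rewrite invr_gt0 ltr0n/= invf_lt1// ltr1n.
apply: cvg_EFin; first exact: nearW.
rewrite -[X in _ --> X]subr0; apply: cvgB; first exact: cvg_cst.
have /cvg_at_rightP := powR_cvg0 p0.
apply; split => [n|]; first by rewrite invr_gt0.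
have := @cvg_harmonic R; rewrite -(cvg_shiftS (@harmonic R)); exact.
Qed.

Lemma eBeta1 p : 0 < p -> eBeta p 1 = (p^-1)%:E.
Proof.
move=> p0.
have mf D : measurable_fun D (fun x => (x `^ (p - 1))%:E).
  by apply/measurable_EFinP; apply: measurable_funTS.
transitivity (\int[mu]_(x in `]0%R, 1%R[) (x `^ (p - 1))%:E)%E.
  rewrite [RHS]integral_mkcond; apply: eq_integral => x _.
  rewrite patchE mem_setE in_itv/= /tpow subrr subr_gt0 powRr0.
  by case: (0 < x); case: (x < 1); rewrite /= ?mulr1 ?mulr0 ?mul0r.
rewrite (@integral_itv_bndo_bndc _ (BRight 0) 1)//.
have := integral_powR_unit p p0.
under eq_integral do rewrite EFinM.
rewrite ge0_integralZl_EFin ?(ltW p0)//;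
  [|by move=> x _; rewrite lee_fin powR_ge0|exact: mf].
move=> /(congr1 (fun z => (p^-1)%:E * z)%E).
by rewrite mule1 muleA -EFinM mulVf ?gt_eqF// mul1e.
Qed.

(** The integrand is the density of the exponential law of rate [1]. *)
Lemma eGamma1 : eGamma 1 = 1%E :> \bar R.
Proof.
have mE (D : set R) : measurable_fun D (fun x => (expR (- x))%:E).
  apply/measurable_EFinP/measurable_funTS.
  by apply: measurableT_comp => //; exact: measurable_funN.
rewrite -(@integral_exponential_pdf R 1 ltr01).
transitivity (\int[mu]_(x in `]0%R, +oo[) (expR (- x))%:E)%E.
  rewrite [RHS]integral_mkcond; apply: eq_integral => x _.
  rewrite patchE mem_setE in_itv/= andbT /tpow subrr powRr0.
  by case: (0 < x); rewrite ?mul1r ?mul0r.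
rewrite integral_itv_obnd_cbnd// [LHS]integral_mkcond; apply: eq_integral => x _.
by rewrite /exponential_pdf !patchE; case: ifP => _; rewrite ?mul1r ?mulN1r.
Qed.

(** Euler's identity with [q = 1]. *)
Lemma eGammaS p : 0 < p -> eGamma (p + 1) = (p%:E * eGamma p)%E.
Proof.
move=> p0; have := eGammaM p 1; rewrite eGamma1 mule1 eBeta1// => ->.
by rewrite muleA -EFinM divff ?mul1e// gt_eqF.
Qed.

(** On [[1, 2]] the integrand is at least [2^-1 * expR (- 2)], because
    [x `^ (p - 1)] is at least [x^-1] there. *)
Lemma eGamma_gt0 p : 0 < p -> (0 < eGamma p)%E.
Proof.
move=> p0.
have : (\int[mu]_(x in `[1%R, 2%R]) (2^-1 * expR (- 2))%:E <= eGamma p)%E.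
  rewrite integral_mkcond; apply: ge0_le_integral => //.
  - by move=> x _; rewrite patchE; case: ifP => // _; rewrite lee_fin mulr_ge0 ?expR_ge0.
  - apply/(measurable_restrictT _ _).1 => //.
  - exact: measurable_eGamma_integrand.
  - move=> x _; rewrite patchE mem_setE in_itv/=; case: ifP => [/andP[x1 x2]|_].
      have x0 : 0 < x by exact: lt_le_trans x1.
      rewrite lee_fin /tpow x0 ler_pM ?expR_ge0 ?ler_expR ?lerN2//.
      rewrite (@le_trans _ _ (x `^ (- 1)))//.
        by rewrite powR_inv1 ?(ltW x0)// lef_pV2 ?posrE.
      by rewrite ler_powR// lerBrDr addrC subrr ltW.
    by rewrite lee_fin mulr_ge0 ?tpow_ge0 ?expR_ge0.
apply: lt_le_trans.
rewrite integral_cst// [X in (_ * X)%E](_ : _ = 1%E) ?mule1 ?lte_fin ?mulr_gt0 ?expR_gt0//.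
rewrite /= lebesgue_measure_itv/= lte_fin ltr1n -EFinB; congr EFin; ring.
Qed.

Lemma eGamma_nat_fin n : eGamma (n.+1%:R : R) \is a fin_num.
Proof.
elim: n => [|n ih]; first by rewrite eGamma1.
by rewrite -natr1 eGammaS// fin_numM.
Qed.

(** For [1 <= p] the integrand is at most that of [Gamma 1] where [x < 1] and at
    most that of [Gamma n], for an integer [n >= p], where [1 <= x]; the functional
    equation brings the case [p < 1] down to this one. *)
Lemma eGamma_fin p : 0 < p -> eGamma p \is a fin_num.
Proof.
move=> p0.
have mG := measurable_eGamma_integrand.
have G0 r x : (0 <= (tpow r x * expR (- x))%:E)%E.
  by rewrite lee_fin mulr_ge0 ?tpow_ge0 ?expR_ge0.
suff fin1 (r : R) : 1 <= r -> eGamma r \is a fin_num.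
  have := fin1 (p + 1); rewrite lerDr (ltW p0) eGammaS// => /(_ isT).
  rewrite !ge0_fin_numE ?eGamma_ge0 ?mule_ge0 ?lee_fin ?eGamma_ge0 ?(ltW p0)//.
  by rewrite !ltey; apply: contra => /eqP ->; rewrite gt0_muley ?lte_fin.
move=> r1.
pose n := (Num.truncn r).
have rn : r <= n.+1%:R by apply/ltW/truncnS_gt.
suff le_r : (eGamma r <= eGamma 1 + eGamma n.+1%:R)%E.
  rewrite ge0_fin_numE ?eGamma_ge0// (le_lt_trans le_r)// -ge0_fin_numE.
    by rewrite fin_numD eGamma1 eGamma_nat_fin.
  by rewrite adde_ge0 ?eGamma_ge0.
rewrite -ge0_integralD//; [|exact: mG|exact: mG].
apply: ge0_le_integral => //; first exact: mG.
  by apply: emeasurable_funD; exact: mG.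
move=> x _; rewrite -EFinD lee_fin -mulrDl ler_wpM2r ?expR_ge0//.
rewrite /tpow; case: ifP => [x0|_]; last by rewrite addr0.
rewrite subrr powRr0.
have [x1|x1] := leP 1 x.
  by rewrite (le_trans (ler_powR x1 (lerB rn (lexx 1))))// lerDr.
rewrite (@le_trans _ _ 1) ?lerDl ?powR_ge0//.
by rewrite -[leRHS](powRr0 x) ger_powR ?x0 ?(ltW x1)// subr_ge0.
Qed.

(** * Real-valued Gamma function and Beta integrals on a segment *)

Lemma eGammaE p : 0 < p -> eGamma p = (Gamma p)%:E.
Proof.
move=> p0; rewrite -(fineK (eGamma_fin p p0)); congr (fine _)%:E.
rewrite [RHS]integral_mkcond; apply: eq_integral => x _.
rewrite patchE mem_setE in_itv/= andbT /tpow.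
by case: (0 < x) => //; rewrite mul0r.
Qed.

Lemma Gamma_gt0 p : 0 < p -> 0 < Gamma p.
Proof. by move=> p0; rewrite -lte_fin -eGammaE// eGamma_gt0. Qed.

Lemma Gamma1 : Gamma 1 = 1 :> R.
Proof. by apply: EFin_inj; rewrite -eGammaE// eGamma1. Qed.

Lemma GammaS p : 0 < p -> Gamma (p + 1) = p * Gamma p.
Proof.
move=> p0; apply: EFin_inj.
by rewrite EFinM -!eGammaE ?addr_gt0// eGammaS.
Qed.

Lemma eBetaE p q : 0 < p -> 0 < q ->
  eBeta p q = (Gamma p * Gamma q / Gamma (p + q))%:E.
Proof.
move=> p0 q0; have pq0 := addr_gt0 p0 q0.
have := eGammaM p q; rewrite !eGammaE// => /(congr1 (fun z => z * (Gamma (p + q))^-1%:E)%E).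
by rewrite -[RHS]muleA -!EFinM divff ?mule1 ?gt_eqF ?Gamma_gt0.
Qed.

(** Translated by [a], the integral is the convolution of two truncated powers at
    [b - a]; exponents [0] are allowed, which covers the integral of one power. *)
Lemma Rintegral_powRM (a b p q : R) : a < b -> 0 <= p -> 0 <= q ->
  \int[mu]_(x in `[a, b]) ((x - a) `^ p * (b - x) `^ q) =
  (b - a) `^ (p + q + 1) * (Gamma (p + 1) * Gamma (q + 1) / Gamma (p + q + 1 + 1)).
Proof.
move=> ab p0 q0; apply: EFin_inj.
have p10 : 0 < p + 1 by rewrite ltr_wpDl.
have q10 : 0 < q + 1 by rewrite ltr_wpDl.
have -> : p + q + 1 + 1 = (p + 1) + (q + 1) by ring.
have ba0 : 0 < b - a by rewrite subr_gt0.
have mh (D : set R) : measurable_fun D (fun x => (x - a) `^ p * (b - x) `^ q).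
  apply: measurable_funTS; apply: measurable_funM.
    by apply: (measurableT_comp (measurable_powR _)); exact: measurable_funB.
  by apply: (measurableT_comp (measurable_powR _)); exact: measurable_funB.
have E : (\int[mu]_(x in `[a, b]) ((x - a) `^ p * (b - x) `^ q)%:E =
    ((b - a) `^ (p + q + 1))%:E * eBeta (p + 1) (q + 1))%E.
  transitivity (\int[mu]_x (tpow (p + 1) (x - a) * tpow (q + 1) (b - x))%:E)%E.
    rewrite integral_itv_bndoo; last exact/measurable_EFinP.
    rewrite [LHS]integral_mkcond; apply: eq_integral => x _.
    rewrite patchE mem_setE in_itv/= /tpow !subr_gt0 !addrK.
    by case: (a < x); case: (x < b); rewrite /= ?mulr0 ?mul0r.
  rewrite (@ge0_integral_affine _ 1 a)//; last 2 first.
    apply/measurable_EFinP/measurable_funM.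
      by apply: measurableT_comp; [exact: measurable_tpow|exact: measurable_funB].
    by apply: measurableT_comp; [exact: measurable_tpow|exact: measurable_funB].
    by move=> x; rewrite lee_fin mulr_ge0 ?tpow_ge0.
  rewrite mul1e.
  have shiftE (x : R) : b - (x + a) = b - a - x by ring.
  under eq_integral do rewrite mul1r addrK shiftE.
  rewrite tpow_convolution /tpow ba0.
  by congr ((_ `^ _)%:E * _)%E; ring.
by rewrite /Rintegral E eBetaE// -EFinM.
Qed.

Lemma Rintegral_powR_subr (a b p : R) : a < b -> 0 < p ->
  \int[mu]_(x in `[a, b]) (x - a) `^ p = (b - a) `^ (p + 1) / (p + 1).
Proof.
move=> ab p0.
have p10 : 0 < p + 1 by rewrite addr_gt0.
transitivity (\int[mu]_(x in `[a, b]) ((x - a) `^ p * (b - x) `^ 0)).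
  by apply: eq_Rintegral => x _; rewrite powRr0 mulr1.
rewrite Rintegral_powRM ?(ltW p0)// addr0 add0r Gamma1 (GammaS (p + 1))//.
by field; rewrite !gt_eqF// Gamma_gt0.
Qed.

Lemma Rintegral_powR_subl (a b p : R) : a < b -> 0 < p ->
  \int[mu]_(x in `[a, b]) (b - x) `^ p = (b - a) `^ (p + 1) / (p + 1).
Proof.
move=> ab p0.
have p10 : 0 < p + 1 by rewrite addr_gt0.
transitivity (\int[mu]_(x in `[a, b]) ((x - a) `^ 0 * (b - x) `^ p)).
  by apply: eq_Rintegral => x _; rewrite powRr0 mul1r.
rewrite Rintegral_powRM ?(ltW p0)// !add0r Gamma1 (GammaS (p + 1))//.
by field; rewrite !gt_eqF// Gamma_gt0.
Qed.

(** The functional equation shifts the three Gamma values to [p], [q] and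
    [p + q + 1]. *)
Lemma Rintegral_powRM_Gamma (a b p q : R) : a < b -> 0 < p -> 0 < q ->
  \int[mu]_(x in `[a, b]) ((x - a) `^ p * (b - x) `^ q) =
  (b - a) `^ (p + q + 1) *
  (p * q * (Gamma p * Gamma q / Gamma (p + q + 1)) / (p + q + 1)).
Proof.
move=> ab p0 q0; have pq0 := addr_gt0 p0 q0.
have pq10 : 0 < p + q + 1 by rewrite addr_gt0.
rewrite Rintegral_powRM ?ltW// !GammaS//.
by field; rewrite !gt_eqF// Gamma_gt0.
Qed.

(** * Integrability and linearity *)

Lemma L1_on_bounded_mul (D : set R) (M : R) (h k : R -> R) :
  measurable D -> measurable_fun setT h -> (forall x, D x -> 0 <= h x <= M) ->
  L1_on D k -> L1_on D (fun x => h x * k x).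
Proof.
move=> mD mh hM kL1.
apply: (@integrableMr _ _ _ mu D mD h (EFin \o k)) => //.
  exact: measurable_funTS.
exists M; split; first exact: num_real.
move=> y My x Dx; have /andP[h0 hx] := hM x Dx.
by rewrite /= ger0_norm// (le_trans hx)// ltW.
Qed.

Lemma L1_on_powR_subr (a b p : R) (k : R -> R) : 0 <= p ->
  L1_on `[a, b] k -> L1_on `[a, b] (fun x => (x - a) `^ p * k x).
Proof.
move=> p0; apply: (@L1_on_bounded_mul _ ((b - a) `^ p)) => //.
  by apply: (measurableT_comp (measurable_powR _)); exact: measurable_funB.
move=> x /=; rewrite in_itv/= => /andP[ax xb].
rewrite powR_ge0 ge0_ler_powR// ?nnegrE ?lerB// subr_ge0//.
exact: le_trans xb.
Qed.

Lemma L1_on_powR_subl (a b p : R) (k : R -> R) : 0 <= p ->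
  L1_on `[a, b] k -> L1_on `[a, b] (fun x => (b - x) `^ p * k x).
Proof.
move=> p0; apply: (@L1_on_bounded_mul _ ((b - a) `^ p)) => //.
  by apply: (measurableT_comp (measurable_powR _)); exact: measurable_funB.
move=> x /=; rewrite in_itv/= => /andP[ax xb].
rewrite powR_ge0 ge0_ler_powR// ?nnegrE ?lerB// subr_ge0//.
exact: le_trans xb.
Qed.

Lemma L1_on_cst1 (a b : R) : L1_on `[a, b] (fun _ : R => 1).
Proof.
apply: continuous_compact_integrable; first exact: segment_compact.
by apply: continuous_subspaceT => x; exact: cvg_cst.
Qed.

Lemma L1_onD (D : set R) (h k : R -> R) : measurable D ->
  L1_on D h -> L1_on D k -> L1_on D (fun x => h x + k x).
Proof.
move=> mD hL kL.
exact: (@integrableD _ _ _ mu D mD (EFin \o h) (EFin \o k) hL kL).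
Qed.

Lemma L1_onZ (D : set R) (c : R) (k : R -> R) : measurable D ->
  L1_on D k -> L1_on D (fun x => c * k x).
Proof.
move=> mD kL; exact: (@integrableZl _ _ _ mu D mD c (EFin \o k) kL).
Qed.

Lemma L1_on_sum4 (D : set R) (c1 c2 c3 c4 : R) (k1 k2 k3 k4 : R -> R) :
  measurable D -> L1_on D k1 -> L1_on D k2 -> L1_on D k3 -> L1_on D k4 ->
  L1_on D (fun x => c1 * k1 x + c2 * k2 x + c3 * k3 x + c4 * k4 x).
Proof. by move=> mD *; do !apply: L1_onD => //; exact: L1_onZ. Qed.

Lemma Rintegral_sum4 (D : set R) (c1 c2 c3 c4 : R) (k1 k2 k3 k4 : R -> R) :
  measurable D -> L1_on D k1 -> L1_on D k2 -> L1_on D k3 -> L1_on D k4 ->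
  \int[mu]_(x in D) (c1 * k1 x + c2 * k2 x + c3 * k3 x + c4 * k4 x) =
  c1 * (\int[mu]_(x in D) k1 x) + c2 * (\int[mu]_(x in D) k2 x) +
  c3 * (\int[mu]_(x in D) k3 x) + c4 * (\int[mu]_(x in D) k4 x).
Proof.
move=> mD L1 L2 L3 L4.
rewrite !RintegralD ?RintegralZl//; try exact: L1_onZ.
- by apply: L1_onD => //; exact: L1_onZ.
- by do !apply: L1_onD => //; exact: L1_onZ.
Qed.

(** * The inequality *)

(** The convexity inequality at [t = (b - x) / (b - a)], for which [x] is
    [t * a + (1 - t) * b]. *)
Lemma s_convex_second_chord (a b s x : R) (h : R -> R) : a < b ->
  s_convex_second s `[a, b] h -> a <= x <= b ->
  h x <= ((b - x) `^ s * h a + (x - a) `^ s * h b) / (b - a) `^ s.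
Proof.
move=> ab hs /andP[ax xb].
have ba0 : 0 < b - a by rewrite subr_gt0.
have ab' := ltW ab.
have := hs a b ((b - x) / (b - a)).
rewrite /= !in_itv/= !lexx ab' divr_ge0 ?subr_ge0 ?ler_pdivrMr ?mul1r ?lerB//.
move=> /(_ isT isT isT).
have -> : 1 - (b - x) / (b - a) = (x - a) / (b - a) by field; rewrite gt_eqF.
have -> : (b - x) / (b - a) * a + (x - a) / (b - a) * b = x.
  by field; rewrite gt_eqF.
have invp : ((b - a)^-1) `^ s = ((b - a) `^ s)^-1.
  by rewrite -powR_inv1 ?(ltW ba0)// powRAC powR_inv1// powR_ge0.
rewrite !powRM ?subr_ge0 ?invr_ge0 ?(ltW ba0)// invp.
by move/le_trans; apply; rewrite le_eqVlt; apply/orP; left; apply/eqP; ring.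
Qed.

End beta_gamma.

Theorem theorem3 (R : realType) (I : set R) (a b s1 s2 : R) (f g : R -> R)
    (I_interval : is_interval I) (I_ge0 : I `<=` `[0, +oo[)
    (Ia : I a) (Ib : I b) (ab : a < b)
    (f_L1 : L1_on `[a, b] f) (g_L1 : L1_on `[a, b] g)
    (fg_L1 : L1_on `[a, b] (fun x => f x * g x))
    (s1_01 : 0 < s1 <= 1) (s2_01 : 0 < s2 <= 1)
    (f_conv : s_convex_second s1 `[a, b] f)
    (g_conv : s_convex_second s2 `[a, b] g) :
  let mu := @lebesgue_measure R in
  let M := f a * g a + f b * g b in
  let N := f a * g b + f b * g a in
  f a / (b - a) `^ (s1 + 1) * (\int[mu]_(x in `[a, b]) ((b - x) `^ s1 * g x))
  + f b / (b - a) `^ (s1 + 1) * (\int[mu]_(x in `[a, b]) ((x - a) `^ s1 * g x))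
  + g a / (b - a) `^ (s2 + 1) * (\int[mu]_(x in `[a, b]) ((b - x) `^ s2 * f x))
  + g b / (b - a) `^ (s2 + 1) * (\int[mu]_(x in `[a, b]) ((x - a) `^ s2 * f x))
  <= 1 / (b - a) * (\int[mu]_(x in `[a, b]) (f x * g x))
     + 1 / (s1 + s2 + 1)
       * (M + s1 * s2 * (Gamma s1 * Gamma s2 / Gamma (s1 + s2 + 1)) * N).
Proof.
cbv zeta; set mu := @lebesgue_measure R.
set M := f a * g a + f b * g b; set N := f a * g b + f b * g a.
have /andP[s10 _] := s1_01; have /andP[s20 _] := s2_01.
have s120 := addr_gt0 s10 s20.
have s1210 : 0 < s1 + s2 + 1 by rewrite addr_gt0.
have D0 : 0 < b - a by rewrite subr_gt0.
have powD s : (b - a) `^ (s + 1) = (b - a) `^ s * (b - a).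
  by rewrite powRD ?(gt_eqF D0) ?implybT// powRr1// ltW.
pose d := (b - a) `^ (s1 + s2) * (b - a).
have mI : measurable (`[a, b]%classic : set R) by exact: measurable_itv.
have L1r s : 0 < s -> L1_on `[a, b] (fun x => (x - a) `^ s).
  move=> s0; rewrite (_ : (fun x => _) = (fun x => (x - a) `^ s * 1)).
    by apply: L1_on_powR_subr (ltW s0) _; exact: L1_on_cst1.
  by apply/funext => x; rewrite mulr1.
have L1l s : 0 < s -> L1_on `[a, b] (fun x => (b - x) `^ s).
  move=> s0; rewrite (_ : (fun x => _) = (fun x => (b - x) `^ s * 1)).
    by apply: L1_on_powR_subl (ltW s0) _; exact: L1_on_cst1.
  by apply/funext => x; rewrite mulr1.
(* The product of the two endpoint bounds, divided by [b - a]. *)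
pose chord x := f a * g a / d * (b - x) `^ (s1 + s2)
  + f b * g b / d * (x - a) `^ (s1 + s2)
  + f a * g b / d * ((x - a) `^ s2 * (b - x) `^ s1)
  + f b * g a / d * ((x - a) `^ s1 * (b - x) `^ s2).
have chord_L1 : L1_on `[a, b] chord.
  apply: L1_on_sum4 => //; [exact: L1l|exact: L1r| |].
  - by apply: L1_on_powR_subr (ltW s20) _; exact: L1l.
  - by apply: L1_on_powR_subr (ltW s10) _; exact: L1l.
have chord_int : \int[mu]_(x in `[a, b]) chord x = 1 / (s1 + s2 + 1)
    * (M + s1 * s2 * (Gamma s1 * Gamma s2 / Gamma (s1 + s2 + 1)) * N).
  rewrite Rintegral_sum4//; [|exact: L1l|exact: L1r|
    by apply: L1_on_powR_subr (ltW s20) _; exact: L1l|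
    by apply: L1_on_powR_subr (ltW s10) _; exact: L1l].
  rewrite Rintegral_powR_subl// Rintegral_powR_subr// !Rintegral_powRM_Gamma//.
  rewrite (addrC s2 s1) powD /d /M /N.
  field.
  by rewrite !gt_eqF ?powR_gt0 ?Gamma_gt0.
rewrite -chord_int -Rintegral_sum4//; last 4 first.
- exact: L1_on_powR_subl (ltW s10) _.
- exact: L1_on_powR_subr (ltW s10) _.
- exact: L1_on_powR_subl (ltW s20) _.
- exact: L1_on_powR_subr (ltW s20) _.
rewrite -RintegralZl// -RintegralD//; last exact: L1_onZ.
apply: le_Rintegral => //.
- apply: L1_on_sum4 => //.
  + exact: L1_on_powR_subl (ltW s10) _.
  + exact: L1_on_powR_subr (ltW s10) _.
  + exact: L1_on_powR_subl (ltW s20) _.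
  + exact: L1_on_powR_subr (ltW s20) _.
- by apply: L1_onD => //; exact: L1_onZ.
move=> x /=; rewrite in_itv/= => axb.
have fx := @s_convex_second_chord R a b s1 x f ab f_conv axb.
have gx := @s_convex_second_chord R a b s2 x g ab g_conv axb.
have powD12 (y : R) : y `^ (s1 + s2) = y `^ s1 * y `^ s2.
  by rewrite powRD// gt_eqF.
rewrite -subr_ge0 /chord /d !powD !powD12.
set P := ((b - x) `^ s1 * f a + (x - a) `^ s1 * f b) / (b - a) `^ s1 in fx.
set Q := ((b - x) `^ s2 * g a + (x - a) `^ s2 * g b) / (b - a) `^ s2 in gx.
(* Both gaps [P - f x] and [Q - g x] are nonnegative, hence so is their product. *)
rewrite [X in 0 <= X](_ : _ = (P - f x) * (Q - g x) / (b - a)).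
  by rewrite divr_ge0 ?(ltW D0)// mulr_ge0// subr_ge0.
rewrite /P /Q; field.
by rewrite !gt_eqF ?powR_gt0.
Qed.
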